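(* Let $\mathsf G$ be a finite group and let $\Lambda$ be a finite connected directed graph cellularly embedded in a closed oriented simply connected surface. Let $H_{\mathsf m}=\sum_v h_v$ be a Hamiltonian on the matter Hilbert space, where each Hermitian term $h_v$ acts on the vertices of a connected subgraph $\Gamma_v$ containing all edges of $\Lambda$ between its vertices and commutes with $\bigotimes_w U_w(g)$ for all $g\in\mathsf G$. Suppose the lowest eigenvalue of $H_{\mathsf m}$ is $0$, that it is non-degenerate with ground state $|\lambda_0\rangle$ satisfying $\bigotimes_wU_w(g)|\lambda_0\rangle=|\lambda_0\rangle$ for all $g$, and that the gap to the next energy level is $\Delta_{\mathsf m}>0$. Let $$H_{\text{full}}=\sum_v\mathcal G_{\Gamma_v}[h_v]+\Delta_{\mathcal B}H_{\mathcal B}+\Delta_PH_P .$$ Then for all sufficiently large $\Delta_{\mathcal B},\Delta_P$, the ground state of $H_{\text{full}}$ is (up to scalar) $G|\lambda_0\rangle$, and the energy gap $\Delta_{\text{full}}$ of $H_{\text{full}}$ above it satisfies $$\Delta_{\text{full}}\ge\min(\Delta_{\mathsf m},\Delta_{\mathcal B},\Delta_P).$$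
   Context: Each vertex $v$ carries a finite-dimensional Hilbert space $\mathbb H_v$ with a unitary representation $U_v$ of $\mathsf G$, and each edge $e$ carries $\mathbb C[\mathsf G]$ with orthonormal basis $\{|g\rangle\}$. The matter space is $\mathbb H_{\mathsf m}=\bigotimes_v\mathbb H_v$, the gauge space is $\mathbb H_{\mathsf g}=\bigotimes_e\mathbb C[\mathsf G]$; $H_{\text{full}}$ acts on $\mathbb H_{\mathsf m}\otimes\mathbb H_{\mathsf g}$. Edge $e$ points from vertex $v_e^+$ to vertex $v_e^-$; $E_v^+$ (resp. $E_v^-$) is the set of edges directed away from (resp. towards) $v$. $R(g)|h\rangle=|hg^{-1}\rangle$, $L(g)|h\rangle=|gh\rangle$. Gauge constraints: $P_v=\frac1{|\mathsf G|}\sum_{g\in\mathsf G}U_v(g)\bigotimes_{e\in E_v^+}R_e(g)\bigotimes_{e\in E_v^-}L_e(g)$, $P=\prod_vP_v$ (the $P_v$ are commuting projectors), $H_P=\sum_v(\mathbb 1-P_v)$. Flux terms: for a plaquette (face) $p$, $\mathcal B_p$ is the projector, diagonal in the group basis of the edges, onto basis states $\bigotimes_e|\phi_e\rangle$ whose holonomy around $\partial p$ is trivial, i.e. $\phi_{e_k}^{\sigma_k}\cdots\phi_{e_1}^{\sigma_1}=1$ where $e_1,\dots,e_k$ are the boundary edges in the order met when following the oriented boundary and $\sigma_i=+1$ if $e_i$ is traversed along its direction, $-1$ otherwise. $H_{\mathcal B}=\sum_p(\mathbb 1-\mathcal B_p)$. State gauging map: $G|\psi\rangle=P\big[|\psi\rangle\otimes\bigotimes_e|1\rangle_e\big]$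 for $|\psi\rangle\in\mathbb H_{\mathsf m}$. Operator gauging map: for an operator $O$ acting on the vertices of a connected subgraph $\Gamma$ (containing all edges between its vertices), $$\mathcal G_\Gamma[O]=\frac1{|\mathsf G|}\sum_{(g_v)\in\mathsf G^{\Gamma}}\Big(\bigotimes_{v\in\Gamma}U_v(g_v)\Big)O\Big(\bigotimes_{v\in\Gamma}U_v(g_v)\Big)^\dagger\otimes\bigotimes_{e\in\Gamma}|g_{v_e^-}g_{v_e^+}^{-1}\rangle\langle g_{v_e^-}g_{v_e^+}^{-1}|_e .$$ *)

(* Defs.v *)
From HB Require Import structures.
From mathcomp Require Import all_boot all_order all_algebra.
From mathcomp Require Import all_fingroup mxrepresentation.
From mathcomp Require Import sesquilinear spectral.
From mathcomp Require Import complex mxtens.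
From mathcomp Require Import reals.

Set Implicit Arguments.
Unset Strict Implicit.
Unset Printing Implicit Defensive.

Import Order.TTheory GRing.Theory Num.Theory.
Local Open Scope ring_scope.
Local Open Scope complex_scope.
Local Open Scope sesquilinear_scope.

(* A dart is an edge together with a direction of traversal: (e, true)
   traverses e along its own direction, (e, false) against it.  Loops and
   multiple edges are allowed. *)
Definition dart (E : finType) : finType := (E * bool)%type.

Definition rev_dart (E : finType) (d : dart E) : dart E := (d.1, ~~ d.2).

(* A directed graph cellularly embedded in a closed oriented surface, given by
   its rotation system: rot sends a dart to the next one, counterclockwise,
   among the darts leaving the same vertex.  Edge e points from vplus e to
   vminus e. *)
Record embedded_digraph (V E : finType) := EmbeddedDigraph {
  vplus : E -> V;
  vminus : E -> V;
  dart_start := fun d : dart E => if d.2 then vplus d.1 else vminus d.1;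
  rot : {perm dart E};
  rotP : forall d, porbit rot d = [set d' | dart_start d' == dart_start d]
}.

Section Embedding.
Variables (V E : finType) (L : embedded_digraph V E).

Definition dart_end (d : dart E) : V := dart_start L (rev_dart d).

Lemma face_next_inj : injective (fun d : dart E => (rot L)^-1%g (rev_dart d)).
Proof.
by move=> [e b] [e' b'] /perm_inj [-> /negb_inj ->].
Qed.

(* Walking along d and turning into the clockwise successor of the reversed
   dart keeps the same face on the left. *)
Definition face_next : {perm dart E} := perm face_next_inj.

Definition faces : {set {set dart E}} := porbits face_next.

(* The oriented boundary of the face to the left of d, read from d. *)
Definition boundary (d : dart E) : seq (dart E) :=
  traject face_next d #|porbit face_next d|.

Definition adjacent_in (S : {set V}) : rel V := fun x y =>
  [&& x \in S, y \in S &
   [exists e, ((vplus L e == x) && (vminus L e == y))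
           || ((vplus L e == y) && (vminus L e == x))]].

(* Connectedness of the subgraph formed by S and all edges between vertices
   of S. *)
Definition connected_on (S : {set V}) : Prop :=
  S != set0 /\ {in S &, forall x y, connect (adjacent_in S) x y}.

Fixpoint walk (x : V) (s : seq (dart E)) (y : V) : bool :=
  if s is d :: s' then (dart_start L d == x) && walk (dart_end d) s' y
  else x == y.

(* Homotopy with fixed endpoints of edge paths in the cell complex made of
   vertices, edges and faces; its classes form the edge-path groupoid. *)
Inductive homotopic (x y : V) : seq (dart E) -> seq (dart E) -> Prop :=
| homotopic_refl s : walk x s y -> homotopic x y s s
| homotopic_sym s t : homotopic x y s t -> homotopic x y t s
| homotopic_trans s t u :
    homotopic x y s t -> homotopic x y t u -> homotopic x y s u
| homotopic_backtrack s d t :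
    walk x (s ++ t) y -> walk x (s ++ [:: d; rev_dart d] ++ t) y ->
    homotopic x y (s ++ t) (s ++ [:: d; rev_dart d] ++ t)
| homotopic_face s d t :
    walk x (s ++ t) y -> walk x (s ++ boundary d ++ t) y ->
    homotopic x y (s ++ t) (s ++ boundary d ++ t).

(* The fundamental group of the surface is the edge-path group of its cell
   decomposition. *)
Definition simply_connected : Prop :=
  forall x s, walk x s x -> homotopic x x s [::].

End Embedding.

Section Tensor.
Variables (C : pzRingType) (I : finType) (n : I -> nat).

(* The product basis of (x)_i C^(n i) is enumerated by the dependent functions
   choosing one basis index for each i. *)
Definition tdim : nat := #|{dffun forall i, 'I_(n i)}|.

Definition tidx (a : 'I_tdim) : {dffun forall i, 'I_(n i)} := enum_val a.

Definition tens_op (A : forall i, 'M[C]_(n i)) : 'M[C]_tdim :=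
  \matrix_(a, b) \prod_i A i (tidx a i) (tidx b i).

Definition tens_vec (psi : forall i, 'cV[C]_(n i)) : 'cV[C]_tdim :=
  \col_a \prod_i psi i (tidx a i) 0.

End Tensor.

Section LocalOperators.
Variables (C : pzRingType) (I : finType) (n : I -> nat) (S : {set I}).

Definition sub_dims (i : {i | i \in S}) : nat := n (val i).

Definition restrict_fun (f : {dffun forall i, 'I_(n i)}) :
    {dffun forall i, 'I_(sub_dims i)} :=
  [ffun i => f (val i)].

Definition restrict_idx (a : 'I_(tdim n)) : 'I_(tdim sub_dims) :=
  enum_rank (restrict_fun (tidx a)).

(* o (x) 1, with o acting on the factors in S. *)
Definition extend_op (o : 'M[C]_(tdim sub_dims)) : 'M[C]_(tdim n) :=
  \matrix_(a, b)
    if [forall i in ~: S, tidx a i == tidx b i]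
    then o (restrict_idx a) (restrict_idx b) else 0.

Definition supported_on (O : 'M[C]_(tdim n)) : Prop := exists o, O = extend_op o.

End LocalOperators.

Section Spectrum.
Variables (R : realType) (n : nat) (H : 'M[R[i]]_n).

Definition energy (E : R[i]) : Prop :=
  exists2 psi : 'cV[R[i]]_n, psi != 0 & H *m psi = E *: psi.

(* The order on R[i] only compares numbers with the same imaginary part. *)
Definition lowest_energy (E0 : R[i]) : Prop :=
  energy E0 /\ forall E, energy E -> E0 <= E.

Definition unique_ground_state (E0 : R[i]) (phi : 'cV[R[i]]_n) : Prop :=
  [/\ lowest_energy E0, phi != 0 &
      forall psi, H *m psi = E0 *: psi <-> exists c, psi = c *: phi].

Definition gap_above (E0 : R[i]) (Delta : R) : Prop :=
  [/\ lowest_energy E0, 0 < Delta, energy (E0 + Delta%:C) &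
      forall E, energy E -> E != E0 -> E0 + Delta%:C <= E].

End Spectrum.

Section Gauging.
Variables (R : realType) (gT : finGroupType) (V E : finType).
Variables (L : embedded_digraph V E) (d : V -> nat).
Variable U : forall v, mx_representation R[i] [set: gT]%G (d v).

Notation C := R[i].

(* Basis of C[G] : the index enum_rank g stands for |g>. *)
Definition ket (g : gT) : 'cV[C]_#|gT| := delta_mx (enum_rank g) 0.

Definition ketbra (g : gT) : 'M[C]_#|gT| :=
  delta_mx (enum_rank g) (enum_rank g).

(* R(g)|h> = |h g^-1> and L(g)|h> = |g h>. *)
Definition Rop (g : gT) : 'M[C]_#|gT| :=
  \matrix_(a, b) (enum_val a == enum_val b * g^-1)%g%:R.

Definition Lop (g : gT) : 'M[C]_#|gT| :=
  \matrix_(a, b) (enum_val a == g * enum_val b)%g%:R.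

Definition edim (e : E) : nat := #|gT|.

Definition mdim : nat := tdim d.
Definition gdim : nat := tdim edim.

(* Operators on the full space are Kronecker products A *t B of a matter
   operator A and a gauge operator B. *)
Definition fdim : nat := (mdim * gdim)%N.

Definition matter_rot (g : V -> gT) : 'M[C]_mdim :=
  tens_op (fun w => U w (g w)).

Definition global_sym (g : gT) : 'M[C]_mdim := matter_rot (fun=> g).

(* The two factors are both nontrivial exactly when e is a loop at v; they
   commute. *)
Definition gauge_factor (v : V) (g : gT) (e : E) : 'M[C]_(edim e) :=
  (if vplus L e == v then Rop g else 1%:M) *m
  (if vminus L e == v then Lop g else 1%:M).

Definition Pv (v : V) : 'M[C]_fdim :=
  #|gT|%:R^-1 *: \sum_(g : gT)
    tens_op (fun w => if w == v then U w g else 1%:M)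
      *t tens_op (gauge_factor v g).

Definition Pgauge : 'M[C]_fdim := \big[mulmx/1%:M]_(v : V) Pv v.

Definition H_P : 'M[C]_fdim := \sum_(v : V) (1%:M - Pv v).

(* The group element on edge e in the basis state of index a. *)
Definition edge_val (a : 'I_gdim) (e : E) : gT := enum_val (tidx a e).

Definition dart_val (phi : E -> gT) (x : dart E) : gT :=
  if x.2 then phi x.1 else (phi x.1)^-1%g.

(* For s = [:: x_1; ...; x_k] this is the product x_k * ... * x_1. *)
Definition holonomy (phi : E -> gT) (s : seq (dart E)) : gT :=
  foldl (fun acc x => dart_val phi x * acc)%g 1%g s.

(* Changing the starting dart only conjugates the holonomy. *)
Definition flat_at (p : {set dart E}) (phi : E -> gT) : bool :=
  [forall x in p, holonomy phi (boundary L x) == 1%g].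

Definition Bp (p : {set dart E}) : 'M[C]_fdim :=
  (1%:M : 'M[C]_mdim) *t diag_mx (\row_a (flat_at p (edge_val a))%:R).

Definition H_B : 'M[C]_fdim := \sum_(p in faces L) (1%:M - Bp p).

Definition gauge_vacuum : 'cV[C]_gdim := tens_vec (fun e : E => ket 1%g : 'cV_(edim e)).

Definition state_gauging (psi : 'cV[C]_mdim) : 'cV[C]_fdim :=
  Pgauge *m (psi *t gauge_vacuum : 'cV[C]_fdim).

(* Elements of G^S are extended by 1 outside S, so that matter_rot g acts
   as the identity there. *)
Definition op_gauging (S : {set V}) (O : 'M[C]_mdim) : 'M[C]_fdim :=
  #|gT|%:R^-1 *: \sum_(g : {ffun V -> gT} | [forall w in ~: S, g w == 1%g])
    (matter_rot g *m O *m (matter_rot g)^t*)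
      *t tens_op (fun e : E =>
           if (vplus L e \in S) && (vminus L e \in S)
           then ketbra (g (vminus L e) * (g (vplus L e))^-1)%g
           else 1%:M : 'M[C]_(edim e)).

Definition H_matter (h : V -> 'M[C]_mdim) : 'M[C]_mdim := \sum_(v : V) h v.

Definition H_full (Gam : V -> {set V}) (h : V -> 'M[C]_mdim)
    (DeltaB DeltaP : R) : 'M[C]_fdim :=
  \sum_(v : V) op_gauging (Gam v) (h v)
    + DeltaB%:C *: H_B + DeltaP%:C *: H_P.

End Gauging.

(* Main.v *)
Require Import Defs.
From mathcomp Require Import all_boot all_order all_algebra.
From mathcomp Require Import all_fingroup mxrepresentation.
From mathcomp Require Import sesquilinear spectral.
From mathcomp Require Import complex mxtens.
From mathcomp Require Import reals.

Set Implicit Arguments.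
Unset Strict Implicit.
Unset Printing Implicit Defensive.

Import Order.TTheory GRing.Theory Num.Theory.
Local Open Scope ring_scope.
Local Open Scope complex_scope.
Local Open Scope sesquilinear_scope.

(** The gauged terms, the vertex projectors P_v and the plaquette projectors
    B_p commute.  An eigenvector of H_full not fixed by all the projectors can
    be projected to a joint eigenvector with eigenvalue 0 for at least one of
    them; it pays at least one penalty, so its energy is at least Delta_m once
    the penalties are large compared with the gauged part.  A state
    fixed by all the projectors is supported on flat configurations, which are
    gauge translates of the trivial one because the surface is simply
    connected; hence it is determined by its matter component over the trivial
    configuration, and the gauged terms act on that component exactly as
    H_m.  This identifies the low energy sector with symmetric matter states,
    with E0 = 0. *)

(** * Spectra of Hermitian matrices with penalty terms *)

Section Spectral.
Variable R : realType.
Implicit Types n : nat.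

Lemma hermsymmxP n (A : 'M[R[i]]_n) : reflect (A^t* = A) (A \is hermsymmx).
Proof.
apply: (iffP (is_hermitianmxP _ _ _)); rewrite expr0 scale1r => e.
- by rewrite -e.
- by rewrite -[LHS]e.
Qed.

(** The values [f] are the real diagonal entries in a unitary diagonalisation. The second clause,
    where diagonalisability is essential, later guarantees that an excited level exists. *)
Lemma hermitian_energies n (H : 'M[R[i]]_n) : H \is hermsymmx ->
  exists f : 'I_n -> R,
    (forall E, energy H E <-> exists i, E = (f i)%:C) /\
    (H != 0 -> exists i, f i != 0).
Proof.
move=> hH; have /orthomx_spectralP eH := hermitian_normalmx hH.
have realD := hermitian_spectral_diag_real hH.
set P := spectralmx H in eH; set D := spectral_diag H in eH realD.
have uP : P \in unitmx by exact: spectral_unit.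
have Di i : D 0 i = (complex.Re (D 0 i))%:C.
  by rewrite RRe_real //; have /mxOverP := realD; apply.
exists (fun i => complex.Re (D 0 i)); split=> [E|H0].
  split=> [[psi psi0 ev]|[i ->]].
    have Ppsi0 : P *m psi != 0.
      apply: contra_neq psi0 => /(congr1 (mulmx (invmx P))).
      by rewrite mulKmx // mulmx0.
    have /cV0Pn [i psii] := Ppsi0.
    exists i; rewrite -Di; apply: (mulIf psii).
    have: P *m (H *m psi) = E *: (P *m psi) by rewrite ev scalemxAr.
    rewrite eH -!mulmxA mulKVmx // => /matrixP /(_ i 0).
    by rewrite mul_diag_mx !mxE => ->.
  exists (invmx P *m delta_mx i 0).
    apply/eqP => /(congr1 (mulmx P)); rewrite mulKVmx // mulmx0.
    by move=> /matrixP /(_ i 0) /eqP; rewrite !mxE !eqxx oner_eq0.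
  rewrite {1}eH -!mulmxA mulKVmx // -Di scalemxAr; congr (_ *m _).
  apply/matrixP => j k; rewrite mul_diag_mx !mxE.
  by case: (j =P i) => [->|_] //=; rewrite !mulr0.
case: (altP (@forallP _ (fun i => complex.Re (D 0 i) == 0))) => [all0|]; last first.
  by rewrite negb_forall => /existsP [i Hi]; exists i.
have D0 : diag_mx D = 0.
  by apply/matrixP => i j; rewrite !mxE Di (eqP (all0 i)) mul0rn.
by case/eqP: H0; rewrite eH D0 mulmx0 mul0mx.
Qed.

Lemma energy_lower_bound n (H : 'M[R[i]]_n) : H \is hermsymmx ->
  exists2 c : R, 0 <= c & forall E, energy H E -> (- c)%:C <= E.
Proof.
move=> /hermitian_energies [f [fE _]].
(* The sum of absolute values dominates every single [- f i] and is nonnegative even in dimension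
   0. *)
exists (\sum_i `|f i|); first by apply: sumr_ge0.
move=> E /fE [i ->]; rewrite lecR lerNl (bigD1 i) //=.
by rewrite (le_trans (ler_norm _)) // normrN lerDl sumr_ge0.
Qed.

(** The idempotents are treated one after another: a vector killed by [Q i] is kept, any other is
    replaced by its image under [Q i]. Commutation preserves the eigenvalue equation and the choices
    already made. The last clause lets one prescribed [Q i] annihilate the result. *)
Lemma joint_eigenvector (F : fieldType) n (I : eqType) (Q : I -> 'M[F]_n)
    (A : 'M[F]_n) (E : F) (psi : 'cV[F]_n) (s : seq I) :
  (forall i, Q i *m Q i = Q i) -> (forall i j, Q i *m Q j = Q j *m Q i) ->
  (forall i, A *m Q i = Q i *m A) -> psi != 0 -> A *m psi = E *: psi ->
  exists chi : 'cV[F]_n, [/\ chi != 0, A *m chi = E *: chi,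
    forall i, i \in s -> Q i *m chi = 0 \/ Q i *m chi = chi &
    forall i, Q i *m psi = 0 -> Q i *m chi = 0].
Proof.
move=> idQ cQ cA psi0 ev; elim: s => [|i s [chi [chi0 evc js z]]].
  by exists psi.
have [Qi0|Qi0] := eqVneq (Q i *m chi) 0.
  exists chi; split=> // j; rewrite inE => /predU1P [->|/js //]; by left.
exists (Q i *m chi); split=> //.
- by rewrite mulmxA cA -mulmxA evc scalemxAr.
- move=> j; rewrite inE => /predU1P [->|/js].
    by right; rewrite mulmxA idQ.
  rewrite mulmxA cQ -mulmxA.
  by case=> ->; [left; rewrite mulmx0 | right].
- by move=> j /z e; rewrite mulmxA cQ -mulmxA e mulmx0.
Qed.

(** If [Q i0] moves [psi], then [psi - Q i0 *m psi] is a nonzero eigenvector killed by [Q i0], and a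
    joint eigenvector [chi] obtained from it pays the penalty [D i0]. Since [K] contributes at least
    [- c], the energy is at least [D i0 - c]. *)
Lemma penalty_bound n (I : finType) (Q : I -> 'M[R[i]]_n) (K H : 'M[R[i]]_n)
    (D : I -> R) (c m : R) (E : R[i]) (psi : 'cV[R[i]]_n) :
  H = K + \sum_i (D i)%:C *: (1%:M - Q i) ->
  (forall i, Q i *m Q i = Q i) -> (forall i j, Q i *m Q j = Q j *m Q i) ->
  (forall i, K *m Q i = Q i *m K) ->
  (forall E', energy K E' -> (- c)%:C <= E') ->
  0 <= c -> 0 <= m -> (forall i, m + c <= D i) ->
  H *m psi = E *: psi -> (exists i, Q i *m psi != psi) -> m%:C <= E.
Proof.
move=> eH idQ cQ cK lbK c0 m0 lbD ev [i0 ne].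
have cH i : H *m Q i = Q i *m H.
  rewrite eH mulmxDl mulmxDr cK; congr (_ + _).
  rewrite mulmx_suml mulmx_sumr; apply: eq_bigr => j _.
  by rewrite -scalemxAl -scalemxAr mulmxBl mulmxBr mulmx1 mul1mx cQ.
have [||chi [chi0 evc js /(_ i0)]] := @joint_eigenvector _ n I Q H E
  (psi - Q i0 *m psi) (enum I) idQ cQ cH.
- by rewrite subr_eq0 eq_sym.
- by rewrite mulmxBr mulmxA cH -mulmxA ev -scalemxAr scalerBr.
rewrite mulmxBr mulmxA idQ subrr.
move=> /(_ erefl) z.
pose b i : R := if Q i *m chi == 0 then 1 else 0.
have Qchi i : (1%:M - Q i) *m chi = (b i)%:C *: chi.
  rewrite mulmxBl mul1mx /b.
  have [->|ne0] := eqVneq (Q i *m chi) 0; first by rewrite subr0 scale1r.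
  have [|e|->] := js i; first by rewrite mem_enum.
    by rewrite e eqxx in ne0.
  by rewrite subrr scale0r.
(* On [chi] every penalty acts as a scalar, so [chi] is an eigenvector of [K] too and the lower
   bound on its spectrum applies. *)
have evK : K *m chi = (E - (\sum_i D i * b i)%:C) *: chi.
  have eK : K = H - \sum_i (D i)%:C *: (1%:M - Q i) by rewrite eH addrK.
  rewrite eK mulmxBl evc scalerBl mulmx_suml rmorph_sum scaler_suml.
  congr (_ - _); apply: eq_bigr => i _.
  by rewrite -scalemxAl Qchi scalerA rmorphM.
have := lbK _ (ex_intro2 _ _ chi chi0 evK).
rewrite lerBrDr -rmorphD => le; apply: le_trans le.
have D0 i : 0 <= D i by rewrite (le_trans _ (lbD i)) // addr_ge0.
rewrite lecR addrC lerBrDr (bigD1 i0) //= {1}/b z eqxx mulr1.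
rewrite (le_trans (lbD i0)) // lerDl sumr_ge0 // => i _.
by rewrite mulr_ge0 // /b; case: ifP.
Qed.

(** The gap is the least nonzero eigenvalue; the condition [H != 0] makes the set of such
    eigenvalues nonempty. *)
Lemma gap_aboveI n (H : 'M[R[i]]_n) (m : R) :
  H \is hermsymmx -> H != 0 -> 0 < m -> lowest_energy H 0 ->
  (forall E, energy H E -> E != 0 -> m%:C <= E) ->
  exists2 D : R, gap_above H 0 D & m <= D.
Proof.
move=> hH H0 m0 low gap; have [f [fE /(_ H0) [i0 fi0]]] := hermitian_energies hH.
have := @arg_minP _ R _ i0 [pred i | f i != 0] f fi0.
case=> i /= fi mini.
have mf : m <= f i.
  by rewrite -lecR; apply: gap; [apply/fE; exists i|rewrite fmorph_eq0].
exists (f i) => //; split=> //; first exact: lt_le_trans mf.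
- by rewrite add0r; apply/fE; exists i.
- move=> E /fE [j ->]; rewrite fmorph_eq0 add0r lecR; exact: mini.
Qed.

End Spectral.

(** * Adjoints of complex matrices *)

Section Adjoint.
Variable C : numClosedFieldType.

Lemma adjmxM m n p (A : 'M[C]_(m, n)) (B : 'M_(n, p)) :
  (A *m B)^t* = B^t* *m A^t*.
Proof. by rewrite trmx_mul map_mxM. Qed.

Lemma adjmx_tens m n p q (A : 'M[C]_(m, n)) (B : 'M[C]_(p, q)) :
  (A *t B)^t* = A^t* *t B^t*.
Proof. by rewrite trmx_tens map_mxT. Qed.

Lemma adjmxD m n (A B : 'M[C]_(m, n)) : (A + B)^t* = A^t* + B^t*.
Proof. by rewrite linearD map_mxD. Qed.

Lemma adjmxB m n (A B : 'M[C]_(m, n)) : (A - B)^t* = A^t* - B^t*.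
Proof. by rewrite linearB map_mxB. Qed.

Lemma adjmxZ m n (c : C) (A : 'M[C]_(m, n)) : (c *: A)^t* = c^* *: A^t*.
Proof. by rewrite linearZ map_mxZ. Qed.

Lemma adjmx_sum m n (I : Type) (r : seq I) (P : pred I) (F : I -> 'M[C]_(m, n)) :
  (\sum_(i <- r | P i) F i)^t* = \sum_(i <- r | P i) (F i)^t*.
Proof. by rewrite linear_sum raddf_sum. Qed.

Lemma adjmx1 n : (1%:M : 'M[C]_n)^t* = 1%:M.
Proof. by rewrite trmx1 map_mx1. Qed.

Lemma adjmx_diag_nat n (b : 'I_n -> nat) :
  (diag_mx (\row_i (b i)%:R) : 'M[C]_n)^t* = diag_mx (\row_i (b i)%:R).
Proof.
by rewrite tr_diag_mx map_diag_mx; congr diag_mx; apply/rowP=> i; rewrite !mxE rmorph_nat.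
Qed.

End Adjoint.

(** * Products of commuting idempotents *)

Section IdempotentProduct.
Variables (F : comPzRingType) (n : nat) (I : eqType) (Q : I -> 'M[F]_n).

Lemma mulmx_big_comm (X : 'M[F]_n) (s : seq I) :
  (forall i, X *m Q i = Q i *m X) ->
  X *m \big[mulmx/1%:M]_(i <- s) Q i = (\big[mulmx/1%:M]_(i <- s) Q i) *m X.
Proof.
move=> cX; elim: s => [|i s IH]; first by rewrite big_nil mulmx1 mul1mx.
by rewrite big_cons mulmxA cX -mulmxA IH mulmxA.
Qed.

Lemma mulmx_big_absorb (s : seq I) i :
  (forall j, Q j *m Q j = Q j) -> (forall j k, Q j *m Q k = Q k *m Q j) ->
  i \in s ->
  Q i *m \big[mulmx/1%:M]_(j <- s) Q j = \big[mulmx/1%:M]_(j <- s) Q j.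
Proof.
move=> idQ cQ; elim: s => // j s IH; rewrite inE big_cons.
have [<- _|_ /= /IH e] := eqVneq i j; first by rewrite mulmxA idQ.
by rewrite mulmxA cQ -mulmxA e.
Qed.

Lemma mulmx_big_fixed m (X : 'M[F]_(n, m)) (s : seq I) :
  (forall i, Q i *m X = X) -> (\big[mulmx/1%:M]_(i <- s) Q i) *m X = X.
Proof.
move=> fX; elim: s => [|i s IH]; first by rewrite big_nil mul1mx.
by rewrite big_cons -mulmxA IH.
Qed.

End IdempotentProduct.

(** * Tensor products of operators *)

Section TensorAlgebra.
Variables (I : finType) (n : I -> nat).

Lemma tidx_inj (a b : 'I_(tdim n)) : (forall i, tidx a i = tidx b i) -> a = b.
Proof. by move=> e; apply: enum_val_inj; apply/ffunP. Qed.

(** Distributivity for factors indexed by different types follows from the version over tagged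
    indices, through the bijection between [fprod] and dependent finite functions. The default 0 of
    [untag] sits only at indices that [tagged_with] excludes. *)
Lemma bigA_distr_dffun (R : comPzRingType) (F : forall i, 'I_(n i) -> R) :
  \prod_i \sum_j F i j =
  \sum_(f : {dffun forall i, 'I_(n i)}) \prod_i F i (f i).
Proof.
rewrite (reindex (@dffun_of_fprod I (fun i => 'I_(n i)))) /=; last first.
  exact/onW_bij/dffun_of_fprod_bij.
pose P i : {ffun 'I_(n i) -> R} := [ffun j => F i j].
transitivity (\sum_(t : fprod (fun i => 'I_(n i))) \prod_(i in I) P i (t i)).
  rewrite (big_fprod _ _ P) -(bigA_distr_big_dep
    (tagged_with (fun i => 'I_(n i))) (fun i => untag 0 (P i))).
  apply: eq_bigr => i _; rewrite -(big_tag (fun i => P i)).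
  by apply: eq_bigr => j _; rewrite ffunE.
by apply: eq_bigr => t _; apply: eq_bigr => i _; rewrite !ffunE.
Qed.

Variable C : comPzRingType.

Lemma tens_op_mul (A B : forall i, 'M[C]_(n i)) :
  tens_op A *m tens_op B = tens_op (fun i => A i *m B i).
Proof.
apply/matrixP=> a b; rewrite !mxE.
under [RHS]eq_bigr do rewrite mxE.
rewrite bigA_distr_dffun (reindex_onto (@tidx I n) enum_rank) /=; last first.
  by move=> f _; rewrite /tidx enum_rankK.
apply: eq_big => [j|j _]; first by rewrite /tidx enum_valK eqxx.
by rewrite !mxE -big_split.
Qed.

Lemma eq_tens_op (A B : forall i, 'M[C]_(n i)) :
  (forall i, A i = B i) -> tens_op A = tens_op B.
Proof.
by move=> e; apply/matrixP=> a b; rewrite !mxE; apply: eq_bigr => i _; rewrite e.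
Qed.

Lemma prod_nat_eq (b : I -> bool) :
  \prod_i (b i)%:R = ([forall i, b i])%:R :> C.
Proof.
have [/forallP bT|] := boolP [forall i, b i].
  by apply: big1 => i _; rewrite bT.
rewrite negb_forall => /existsP [i /negbTE bi].
by rewrite (bigD1 i) //= bi mul0r.
Qed.

Lemma tens_op1 : tens_op (fun i => 1%:M : 'M[C]_(n i)) = 1%:M.
Proof.
apply/matrixP=> a b; rewrite !mxE.
under eq_bigr do rewrite mxE.
rewrite prod_nat_eq; congr (_%:R); congr nat_of_bool.
apply/forallP/eqP => [e|-> //]; apply: tidx_inj => i; exact/eqP.
Qed.

(** The two operators act on disjoint sets of tensor factors. In each order, a single intermediate
    basis index contributes to a matrix entry of the product. *)
Lemma extend_op_comm (S : {set I}) (A : forall i, 'M[C]_(n i))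
    (o : 'M[C]_(tdim (@sub_dims I n S))) :
  (forall i, i \in S -> A i = 1%:M) ->
  tens_op A *m extend_op o = extend_op o *m tens_op A.
Proof.
move=> A1; apply/matrixP=> a b; rewrite !mxE.
(* The intermediate index must agree with one argument on [S], where [A] is the identity, and with
   the other off [S], where [extend_op o] is. It is [glue a b] on the left and [glue b a] on the
   right. *)
pose glue (x y : 'I_(tdim n)) : 'I_(tdim n) :=
  enum_rank ([ffun i => if i \in S then tidx x i else tidx y i] :
    {dffun forall i, 'I_(n i)}).
have glueE x y i : tidx (glue x y) i = if i \in S then tidx x i else tidx y i.
  by rewrite /tidx enum_rankK ffunE.
have resE x y : (forall i, i \in S -> tidx x i = tidx y i) ->
    restrict_idx S x = restrict_idx S y.
  move=> e; congr (enum_rank _); apply/ffunP => i; rewrite !ffunE.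
  exact/e/(valP i).
have zero x y i : i \in S -> tidx x i != tidx y i ->
    \prod_i A i (tidx x i) (tidx y i) = 0.
  by move=> iS ne; rewrite (bigD1 i) //= A1 // mxE (negbTE ne) mul0r.
have supp x y : \prod_i A i (tidx x i) (tidx y i) =
  if [forall i in S, tidx x i == tidx y i] then
    \prod_(i in ~: S) A i (tidx x i) (tidx y i) else 0.
  case: ifPn => [/forall_inP e|]; last first.
    by rewrite negb_forall_in => /existsP [i /andP [iS ne]]; apply: (zero _ _ i).
  rewrite (bigID (mem S)) /= big1 ?mul1r.
    by apply: eq_bigl => i; rewrite inE.
  by move=> i iS; rewrite (eqP (e i iS)) A1 // mxE eqxx.
rewrite (bigD1 (glue a b)) //= big1 ?addr0; last first.
  move=> c ne; rewrite !mxE supp; case: ifPn => [/forall_inP e|]; last by rewrite mul0r.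
  case: ifPn => [/forall_inP e'|]; last by rewrite mulr0.
  case/eqP: ne; apply: tidx_inj => i; rewrite glueE.
  by case: ifPn => iS; [rewrite (eqP (e i iS)) | apply/eqP/e'; rewrite inE].
rewrite (bigD1 (glue b a)) //= [X in _ = _ + X]big1 ?addr0; last first.
  move=> c ne; rewrite !mxE supp; case: ifPn => [/forall_inP e'|]; last by rewrite mul0r.
  case: ifPn => [/forall_inP e|]; last by rewrite mulr0.
  case/eqP: ne; apply: tidx_inj => i; rewrite glueE.
  by case: ifPn => iS; [apply/eqP/e | rewrite (eqP (e' i _)) ?inE].
rewrite !mxE !supp.
rewrite !ifT; first last.
- by apply/forall_inP => i iS; rewrite glueE iS.
- by apply/forall_inP => i; rewrite inE glueE => /negbTE ->.
- by apply/forall_inP => i; rewrite inE glueE => /negbTE ->.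
- by apply/forall_inP => i iS; rewrite glueE iS.
rewrite mulrC; congr (o _ _ * _).
- by apply: resE => i iS; rewrite glueE iS.
- by apply: resE => i iS; rewrite glueE iS.
by apply: eq_bigr => i; rewrite inE !glueE => /negbTE ->.
Qed.

End TensorAlgebra.

Lemma tens_op_adj (C : numClosedFieldType) (I : finType) (n : I -> nat)
    (A : forall i, 'M[C]_(n i)) :
  (tens_op A)^t* = tens_op (fun i => (A i)^t*).
Proof.
apply/matrixP=> a b; rewrite !mxE rmorph_prod.
by apply: eq_bigr => i _; rewrite !mxE.
Qed.

(** * Holonomy and flat configurations *)

Section Holonomy.
Variables (gT : finGroupType) (V E : finType) (L : embedded_digraph V E).
Local Open Scope group_scope.
Implicit Types (phi : E -> gT) (s t : seq (dart E)) (x y z : V).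

Lemma holonomy_foldl phi s (a : gT) :
  foldl (fun acc d => dart_val phi d * acc) a s = holonomy phi s * a.
Proof.
rewrite /holonomy; elim: s a => [|d s IH] a /=; first by rewrite mul1g.
by rewrite IH [in RHS]IH mulg1 mulgA.
Qed.

Lemma holonomy_cat phi s t : holonomy phi (s ++ t) = holonomy phi t * holonomy phi s.
Proof. by rewrite /holonomy foldl_cat holonomy_foldl. Qed.

Lemma holonomy_cons phi d s : holonomy phi (d :: s) = holonomy phi s * dart_val phi d.
Proof. by rewrite -cat1s holonomy_cat /holonomy /= mulg1. Qed.

Lemma rev_dartK : involutive (@rev_dart E).
Proof. by case=> e b; rewrite /rev_dart /= negbK. Qed.

Lemma dart_val_rev phi d : dart_val phi (rev_dart d) = (dart_val phi d)^-1.
Proof. by case: d => e [] //=; rewrite /dart_val /= invgK. Qed.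

Lemma walk_cat x y z s t : walk L x s y -> walk L y t z -> walk L x (s ++ t) z.
Proof.
elim: s x => [|d s IH] x /=; first by move/eqP->.
by case/andP=> -> /IH ih /ih.
Qed.

Definition rev_walk s := rev (map (@rev_dart E) s).

Lemma walk_rev x y s : walk L x s y -> walk L y (rev_walk s) x.
Proof.
elim: s x => [|d s IH] x /=; first by rewrite eq_sym.
case/andP=> /eqP dx /IH w; rewrite /rev_walk /= rev_cons -cats1.
by apply: walk_cat w _; rewrite /= eqxx /dart_end rev_dartK dx eqxx.
Qed.

Lemma holonomy_rev phi s : holonomy phi (rev_walk s) = (holonomy phi s)^-1.
Proof.
elim: s => [|d s IH]; first by rewrite /holonomy /= invg1.
rewrite /rev_walk /= rev_cons -cats1 holonomy_cat -/(rev_walk s) IH.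
by rewrite !holonomy_cons invMg dart_val_rev {1}/holonomy /= mul1g.
Qed.

(** The orbits of the rotation are the sets of darts leaving one vertex, so turning from
    [rev_dart d] does not change the starting vertex. *)
Lemma dart_start_face_next d : dart_start L (face_next L d) = dart_end L d.
Proof.
rewrite permE /dart_end; set r := rev_dart d.
have: (Defs.rot L)^-1 r \in porbit (Defs.rot L) r
  by rewrite -porbitV -{1}[(Defs.rot L)^-1]expg1 mem_porbit.
by rewrite rotP inE => /eqP.
Qed.

Lemma walk_traject d k :
  walk L (dart_start L d) (traject (face_next L) d k)
    (dart_start L (iter k (face_next L) d)).
Proof.
elim: k d => [|k IH] d /=; first exact: eqxx.
by rewrite eqxx -dart_start_face_next -iterS iterSr IH.
Qed.

Lemma walk_boundary d : walk L (dart_start L d) (boundary L d) (dart_start L d).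
Proof.
have := walk_traject d #|porbit (face_next L) d|.
by rewrite iter_porbit.
Qed.

(** Each elementary move inserts a factor 1: a backtrack gives a dart value times its inverse, and a
    face boundary is flat by hypothesis. *)
Lemma holonomy_homotopic phi x y s t :
  (forall d, holonomy phi (boundary L d) = 1) ->
  homotopic L x y s t -> holonomy phi s = holonomy phi t.
Proof.
move=> flat; elim=> //.
- by move=> {}s {}t u _ -> _ ->.
- move=> {}s d {}t _ _; rewrite !holonomy_cat /holonomy /= mulg1 dart_val_rev.
  by rewrite mulVg mulg1.
- by move=> {}s d {}t _ _; rewrite !holonomy_cat flat mulg1.
Qed.

(** The head acts by left multiplication and the tail by right multiplication with the inverse, as
    [Lop] and [Rop] do. With [phi] constantly 1 this is a pure gauge configuration. *)
Definition gauge_config (g : V -> gT) (phi : E -> gT) : E -> gT :=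
  fun e => g (vminus L e) * phi e * (g (vplus L e))^-1.

Lemma dart_val_gauge g phi d :
  dart_val (gauge_config g phi) d =
  g (dart_end L d) * dart_val phi d * (g (dart_start L d))^-1.
Proof.
case: d => e []; rewrite /dart_val /dart_end /gauge_config //= /dart_start /=.
by rewrite !invMg invgK mulgA.
Qed.

(** The factors of [g] at interior vertices of the walk cancel. On a closed walk the holonomy is
    only conjugated, hence flatness is gauge invariant. *)
Lemma holonomy_gauge g phi x y s : walk L x s y ->
  holonomy (gauge_config g phi) s = g y * holonomy phi s * (g x)^-1.
Proof.
elim: s x => [|d s IH] x /=; first by move/eqP->; rewrite /holonomy /= mulg1 mulgV.
case/andP=> /eqP <- /IH; rewrite !holonomy_cons dart_val_gauge => ->.
by rewrite !mulgA mulgKV.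
Qed.

Lemma flat_at_gauge g phi p : flat_at L p (gauge_config g phi) = flat_at L p phi.
Proof.
apply: eq_forallb_in => d _; rewrite (holonomy_gauge _ _ (walk_boundary d)).
by rewrite -eq_mulgV1 -{2}[g _]mulg1 (inj_eq (mulgI _)).
Qed.

Lemma flat_at_eq p phi phi' : phi =1 phi' -> flat_at L p phi = flat_at L p phi'.
Proof.
move=> e; apply: eq_forallb_in => d _; congr (_ == _).
rewrite /holonomy; elim: (boundary L d) 1 => //= a s IH b.
by rewrite IH /dart_val e.
Qed.

Lemma connect_walk (S : {set V}) x y :
  connect (adjacent_in L S) x y -> exists s, walk L x s y.
Proof.
case/connectP => p; elim: p x => [|z p IH] x /=; first by move=> _ ->; exists [::] => /=.
case/andP=> /and3P [_ _ /existsP [e adj]] pz ey; have [s w] := IH _ pz ey.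
have [d ds de] : exists2 d : dart E, dart_start L d = x & dart_end L d = z.
  case/orP: adj => /andP [/eqP <- /eqP <-]; first by exists (e, true).
  by exists (e, false).
by exists (d :: s); rewrite /= ds eqxx de.
Qed.

(* The gauge transformation trivialising a flat configuration is its holonomy
   along walks from a base point, path independent since they are homotopic. *)
Lemma flat_is_pure_gauge phi :
  connected_on L [set: V] -> simply_connected L ->
  (forall p, p \in faces L -> flat_at L p phi) ->
  exists g : V -> gT, phi =1 gauge_config g (fun=> 1).
Proof.
move=> [/set0Pn [x0 _] conn] sc flat.
have flatd d : holonomy phi (boundary L d) = 1.
  have /flat/forall_inP /(_ d) : porbit (face_next L) d \in faces L by apply/imsetP; exists d.
  by rewrite porbit_id => /(_ isT)/eqP.
have ex v : exists s, walk L x0 s v.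
  by apply: (@connect_walk [set: V]); apply: conn; rewrite inE.
pose w v := xchoose (ex v); have wP v : walk L x0 (w v) v := xchooseP (ex v).
exists (fun v => holonomy phi (w v)) => e; rewrite /gauge_config mulg1.
have loop : walk L x0 (w (vplus L e) ++ (e, true) :: rev_walk (w (vminus L e))) x0.
  apply: walk_cat (wP _) _; rewrite /= eqxx /=; exact: walk_rev (wP _).
have := holonomy_homotopic flatd (sc _ _ loop).
rewrite holonomy_cat holonomy_cons holonomy_rev /dart_val /= => h.
apply: (mulIg (holonomy phi (w (vplus L e)))); rewrite mulgKV.
apply: (mulgI (holonomy phi (w (vminus L e)))^-1).
by rewrite mulVg mulgA h.
Qed.

End Holonomy.

Lemma tensmx11 (F : comPzRingType) m n :
  (1%:M : 'M[F]_m) *t (1%:M : 'M[F]_n) = 1%:M.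
Proof.
apply/matrixP=> i j.
case: (mxtens_indexP i) => i0 i1; case: (mxtens_indexP j) => j0 j1.
rewrite tensmxE !mxE -natrM mulnb (inj_eq (can_inj (@mxtens_indexK m n))).
by rewrite xpair_eqE.
Qed.

(** * Gauge transformations and the gauging maps *)

Section GaugeTheory.
Variables (R : realType) (gT : finGroupType) (V E : finType).
Variables (L : embedded_digraph V E) (d : V -> nat).
Variable U : forall v, mx_representation R[i] [set: gT]%G (d v).

Notation C := R[i].
Implicit Types (g h : V -> gT) (a b : 'I_(gdim gT E)) (phi : E -> gT).

Definition config_index phi : 'I_(gdim gT E) :=
  enum_rank ([ffun e => enum_rank (phi e)] : {dffun forall e : E, 'I_(edim gT e)}).

Lemma edge_val_index phi e : edge_val (config_index phi) e = phi e.
Proof. by rewrite /edge_val /tidx enum_rankK ffunE enum_rankK. Qed.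

Lemma edge_val_inj a b : edge_val a =1 edge_val b -> a = b.
Proof. by move=> e; apply: tidx_inj => x; apply: enum_val_inj; apply: e. Qed.

Definition gact g a := config_index (gauge_config L g (edge_val a)).

Lemma edge_val_gact g a e :
  edge_val (gact g a) e = (g (vminus L e) * edge_val a e * (g (vplus L e))^-1)%g.
Proof. exact: edge_val_index. Qed.

Definition mulf g h : V -> gT := fun w => (g w * h w)%g.
Definition invf g : V -> gT := fun w => (g w)^-1%g.

Lemma gactM g h a : gact (mulf g h) a = gact g (gact h a).
Proof. by apply: edge_val_inj => e; rewrite !edge_val_gact invMg !mulgA. Qed.

Lemma gact1 a : gact (fun=> 1%g) a = a.
Proof. by apply: edge_val_inj => e; rewrite !edge_val_gact invg1 mul1g mulg1. Qed.

Lemma eq_gact g h : g =1 h -> gact g =1 gact h.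
Proof. by move=> e a; apply: edge_val_inj => x; rewrite !edge_val_gact !e. Qed.

Lemma gactK g : cancel (gact g) (gact (invf g)).
Proof. by move=> a; rewrite -gactM -{2}[a]gact1; apply: eq_gact => w; apply: mulVg. Qed.

Lemma gactVK g : cancel (gact (invf g)) (gact g).
Proof. by move=> a; rewrite -gactM -{2}[a]gact1; apply: eq_gact => w; apply: mulgV. Qed.

Definition gauge_perm g : 'M[C]_(gdim gT E) := \matrix_(a, b) (a == gact g b)%:R.

Lemma mul_mx_gauge_perm g (B : 'M[C]_(gdim gT E)) a b :
  (B *m gauge_perm g) a b = B a (gact g b).
Proof.
rewrite mxE (bigD1 (gact g b)) //= big1 => [|c ne].
  by rewrite !mxE eqxx mulr1 addr0.
by rewrite !mxE (negbTE ne) mulr0.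
Qed.

Lemma gauge_permM g h : gauge_perm g *m gauge_perm h = gauge_perm (mulf g h).
Proof. by apply/matrixP => a b; rewrite mul_mx_gauge_perm !mxE gactM. Qed.

Lemma gauge_perm_adj g : (gauge_perm g)^t* = gauge_perm (invf g).
Proof.
apply/matrixP => a b; rewrite !mxE conjC_nat; congr (_%:R); congr nat_of_bool.
by apply/eqP/eqP => ->; rewrite ?gactK ?gactVK.
Qed.

Lemma matter_rotM g h : matter_rot U g *m matter_rot U h = matter_rot U (mulf g h).
Proof. by rewrite tens_op_mul; apply: eq_tens_op => w; rewrite -repr_mxM ?inE. Qed.

Lemma eq_matter_rot g h : g =1 h -> matter_rot U g = matter_rot U h.
Proof. by move=> e; apply: eq_tens_op => w; rewrite e. Qed.

Lemma matter_rot1 : matter_rot U (fun=> 1%g) = 1%:M.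
Proof. by rewrite -tens_op1; apply: eq_tens_op => w; rewrite repr_mx1. Qed.

Definition gauge_op g : 'M[C]_(fdim gT E d) := matter_rot U g *t gauge_perm g.

Lemma gauge_opM g h : gauge_op g *m gauge_op h = gauge_op (mulf g h).
Proof. by rewrite /gauge_op tensmx_mul matter_rotM gauge_permM. Qed.

Lemma eq_gauge_op g h : g =1 h -> gauge_op g = gauge_op h.
Proof.
move=> e; rewrite /gauge_op (eq_matter_rot e); congr (_ *t _).
by apply/matrixP => a b; rewrite !mxE (eq_gact e).
Qed.

(** * Vertex projectors as averages of gauge transformations at one vertex *)

Definition single (v : V) (k : gT) : V -> gT := fun w => if w == v then k else 1%g.

(** This reduces the algebra of the vertex projectors to multiplication of gauge fields, loops
    included. *)
Lemma PvE v : Pv L U v = #|gT|%:R^-1 *: \sum_k gauge_op (single v k).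
Proof.
congr (_ *: _); apply: eq_bigr => k _; congr (_ *t _).
  apply: eq_tens_op => w; rewrite /single; case: eqP => // _.
  by rewrite repr_mx1.
apply/matrixP => a b; rewrite !mxE.
transitivity (\prod_e (edge_val a e == edge_val (gact (single v k) b) e)%:R : C).
  apply: eq_bigr => e _; rewrite edge_val_gact.
  have -> : gauge_factor R L v k e =
      Rop R (single v k (vplus L e)) *m Lop R (single v k (vminus L e)).
    rewrite /gauge_factor /single; congr (_ *m _); case: ifP => // _.
      apply/matrixP => x y; rewrite !mxE invg1 mulg1.
      by rewrite (inj_eq enum_val_inj).
    by apply/matrixP => x y; rewrite !mxE mul1g (inj_eq enum_val_inj).
  (* Only the basis state that [Lop] produces from the label of [b] on [e] contributes. *)
  rewrite mxE (bigD1 (enum_rank (single v k (vminus L e) * edge_val b e)%g)) //=.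
  rewrite big1 => [|c ne].
    by rewrite !mxE enum_rankK eqxx mulr1 addr0.
  rewrite !mxE; case: (_ =P (_ * enum_val (tidx b e))%g) => [h|]; last by rewrite mulr0.
  by case/eqP: ne; rewrite -[c]enum_valK h.
rewrite prod_nat_eq; congr (_%:R); congr nat_of_bool.
by apply/forallP/eqP => [e|-> //]; apply: edge_val_inj => x; apply/eqP.
Qed.

Lemma gT_neq0 : #|gT|%:R != 0 :> C.
Proof. by rewrite pnatr_eq0 -lt0n; apply/card_gt0P; exists 1%g. Qed.

Lemma average_const (W : lmodType C) (X : W) :
  #|gT|%:R^-1 *: \sum_(k : gT) X = X.
Proof. by rewrite sumr_const -[X *+ _]scaler_nat scalerA mulVf ?scale1r // gT_neq0. Qed.

Lemma Pv_avg v (X : 'M[C]_(fdim gT E d, 1)) :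
  (forall k, gauge_op (single v k) *m X = X) -> Pv L U v *m X = X.
Proof.
move=> fx; rewrite PvE -scalemxAl mulmx_suml.
under eq_bigr do rewrite fx.
exact: average_const.
Qed.

Lemma single_mulf v k k' : mulf (single v k) (single v k') =1 single v (k * k')%g.
Proof. by move=> w; rewrite /mulf /single; case: ifP => //; rewrite mulg1. Qed.

Lemma single_Pv v k : gauge_op (single v k) *m Pv L U v = Pv L U v.
Proof.
rewrite PvE -scalemxAr mulmx_sumr [in RHS](reindex_inj (mulgI k)) /=.
congr (_ *: _); apply: eq_bigr => k' _; rewrite gauge_opM.
exact/eq_gauge_op/single_mulf.
Qed.

(** Conjugation by [g] permutes the fields supported at [v], acting on their values as conjugation
    by [g v], so the average is unchanged. *)
Lemma gauge_op_Pv g v : gauge_op g *m Pv L U v = Pv L U v *m gauge_op g.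
Proof.
rewrite PvE -scalemxAl -scalemxAr mulmx_suml mulmx_sumr.
rewrite [in RHS](reindex_inj (conjg_inj (g v)^-1%g)) /=.
congr (_ *: _); apply: eq_bigr => k _; rewrite !gauge_opM.
apply: eq_gauge_op => w; rewrite /mulf /single; case: eqP => [->|_].
  by rewrite conjgE invgK !mulgA mulgKV.
by rewrite mul1g mulg1.
Qed.

Lemma Pv_idem v : Pv L U v *m Pv L U v = Pv L U v.
Proof.
rewrite {1}PvE -scalemxAl mulmx_suml.
under eq_bigr do rewrite single_Pv.
exact: average_const.
Qed.

Lemma Pv_comm v w : Pv L U v *m Pv L U w = Pv L U w *m Pv L U v.
Proof.
have cw k := gauge_op_Pv (single v k) w.
rewrite (PvE v); move: (Pv L U w) cw => P cw.
rewrite -scalemxAl -scalemxAr mulmx_suml mulmx_sumr.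
by congr (_ *: _); apply: eq_bigr => k _; apply: cw.
Qed.

(** Every field is a product of fields supported at single vertices, and each of those is absorbed
    by the projector at its vertex. *)
Lemma gauge_op_fixed m (X : 'M[C]_(fdim gT E d, m)) g :
  (forall v, Pv L U v *m X = X) -> gauge_op g *m X = X.
Proof.
move=> fx; have fs v k : gauge_op (single v k) *m X = X.
  by rewrite -[in LHS](fx v) mulmxA single_Pv fx.
pose gs (s : seq V) : V -> gT := fun w => if w \in s then g w else 1%g.
suff H s : uniq s -> gauge_op (gs s) *m X = X.
  rewrite -[RHS](H (enum V) (enum_uniq V)); congr (_ *m _).
  by apply: eq_gauge_op => w; rewrite /gs mem_enum.
elim: s => [_|v s IH /= /andP [vs us]].
  have -> : gauge_op (gs [::]) = 1%:M; last by rewrite mul1mx.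
  rewrite /gauge_op /gs (eq_matter_rot (h := fun=> 1%g)) // matter_rot1.
  have -> : gauge_perm (fun w => if w \in [::] then g w else 1%g) = 1%:M.
    by apply/matrixP => a b; rewrite !mxE (eq_gact (h := fun=> 1%g)) // gact1.
  by rewrite tensmx11.
rewrite (eq_gauge_op (h := mulf (single v (g v)) (gs s))).
  by rewrite -gauge_opM -mulmxA IH.
move=> w; rewrite /gs /mulf /single inE.
have [->|_] := eqVneq w v; first by rewrite (negbTE vs) mulg1.
by rewrite mul1g.
Qed.

(** * Plaquette projectors and their commutation relations *)

Lemma flat_at_gact p g a : flat_at L p (edge_val (gact g a)) = flat_at L p (edge_val a).
Proof. by rewrite (flat_at_eq _ _ (edge_val_index _)) flat_at_gauge. Qed.

Lemma gauge_op_Bp g p : gauge_op g *m Bp R gT L d p = Bp R gT L d p *m gauge_op g.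
Proof.
rewrite /gauge_op /Bp !tensmx_mul mul1mx mulmx1; congr (_ *t _).
apply/matrixP => a b; rewrite mul_diag_mx mul_mx_diag !mxE.
case: eqP => [->|_]; last by rewrite mul0r mulr0.
by rewrite flat_at_gact mulrC.
Qed.

Lemma Bp_Pv p v : Bp R gT L d p *m Pv L U v = Pv L U v *m Bp R gT L d p.
Proof.
have cw k := gauge_op_Bp (single v k) p.
rewrite PvE; move: (Bp R gT L d p) cw => B cw.
rewrite -scalemxAl -scalemxAr mulmx_suml mulmx_sumr.
by congr (_ *: _); apply: eq_bigr => k _; rewrite cw.
Qed.

Lemma Bp_comm p q : Bp R gT L d p *m Bp R gT L d q = Bp R gT L d q *m Bp R gT L d p.
Proof. by rewrite /Bp !tensmx_mul diag_mxC. Qed.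

Lemma Bp_idem p : Bp R gT L d p *m Bp R gT L d p = Bp R gT L d p.
Proof.
rewrite /Bp tensmx_mul mulmx1; congr (_ *t _).
apply/matrixP => a b; rewrite mul_diag_mx !mxE.
by case: (flat_at _ _ _); rewrite ?mul1r ?mul0r ?mul0rn.
Qed.

(** * Gauged operators and their commutation with the constraints *)

Hypothesis U_unitary : forall v (k : gT), U v k \is unitarymx.

Lemma matter_rot_adj g : (matter_rot U g)^t* = matter_rot U (invf g).
Proof.
rewrite tens_op_adj; apply: eq_tens_op => w.
rewrite -invmx_unitary //; apply: (can_inj (mulKmx (unitarymx_unit (U_unitary w (g w))))).
rewrite mulmxV ?unitarymx_unit // -repr_mxM ?inE // /invf mulgV repr_mx1 //.
Qed.

Lemma matter_rotV g : matter_rot U g *m matter_rot U (invf g) = 1%:M.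
Proof. by rewrite matter_rotM -matter_rot1; apply: eq_matter_rot => w; apply: mulgV. Qed.

(** The tensor product of the [ketbra] factors, written as one diagonal projector onto the
    configurations that coincide inside [S] with the pure gauge configuration of [g]. *)
Definition agree_proj (S : {set V}) g : 'M[C]_(gdim gT E) :=
  diag_mx (\row_a ([forall e, (vplus L e \in S) && (vminus L e \in S) ==>
     (edge_val a e == g (vminus L e) * (g (vplus L e))^-1)%g])%:R).

Lemma op_gaugingE (S : {set V}) (O : 'M[C]_(mdim d)) :
  op_gauging L U S O = #|gT|%:R^-1 *:
    \sum_(g : {ffun V -> gT} | [forall w in ~: S, g w == 1%g])
      (matter_rot U g *m O *m matter_rot U (invf g)) *t agree_proj S g.
Proof.
congr (_ *: _); apply: eq_bigr => g _; rewrite matter_rot_adj; congr (_ *t _).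
apply/matrixP => a b; rewrite !mxE.
(* Off the diagonal, an edge on which [a] and [b] differ supplies a zero factor. *)
have [<-|ne] := eqVneq a b; last first.
  have [e] : exists e, tidx a e != tidx b e.
    apply/existsP; rewrite -negb_forall; apply: contra ne => /forallP e.
    by apply/eqP/tidx_inj => x; apply/eqP.
  move=> nee; rewrite (bigD1 e) //=; case: ifP => _; last by rewrite mxE (negbTE nee) mul0r.
  rewrite !mxE; case: eqP => [ea|]; last by rewrite mul0r.
  case: eqP => [eb|]; last by rewrite mul0r.
  by rewrite ea eb eqxx in nee.
rewrite mulr1n -prod_nat_eq; apply: eq_bigr => e _; case: ifP => _; last by rewrite mxE eqxx.
rewrite !mxE andbb /edge_val implyTb; congr (_%:R); congr nat_of_bool.
by rewrite -(inj_eq enum_val_inj) enum_rankK.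
Qed.

Lemma gauge_perm_agree_proj S g s :
  gauge_perm s *m agree_proj S g = agree_proj S (mulf s g) *m gauge_perm s.
Proof.
apply/matrixP => a b; rewrite mul_mx_diag mul_diag_mx !mxE.
case: eqP => [->|_]; last by rewrite mul0r mulr0.
rewrite mul1r mulr1; congr (_%:R); congr nat_of_bool.
apply: eq_forallb => e; congr (_ ==> _); rewrite edge_val_gact /mulf invMg !mulgA.
by rewrite (inj_eq (mulIg _)) -mulgA (inj_eq (mulgI _)).
Qed.

(** Moving a gauge transformation supported on [S] through the sum translates the summation field by
    [s], which permutes the fields supported on [S]. *)
Lemma op_gauging_gauge_op_in (S : {set V}) O (s : {ffun V -> gT}) :
  (forall w, w \notin S -> s w = 1%g) ->
  op_gauging L U S O *m gauge_op s = gauge_op s *m op_gauging L U S O.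
Proof.
move=> s1; rewrite op_gaugingE -scalemxAl -scalemxAr mulmx_suml mulmx_sumr.
congr (_ *: _).
pose mul_s (g : {ffun V -> gT}) : {ffun V -> gT} := [ffun w => s w * g w]%g.
have mul_s_inj : injective mul_s.
  by move=> g h /ffunP e; apply/ffunP => w; have := e w; rewrite !ffunE => /mulgI.
rewrite (reindex_inj mul_s_inj) /=; apply: eq_big => [g|g _].
  by apply: eq_forallb_in => w; rewrite inE ffunE => /s1 ->; rewrite mul1g.
rewrite !tensmx_mul gauge_perm_agree_proj; congr (_ *t _); last first.
  congr (_ *m _); congr diag_mx; apply/rowP => a; rewrite !mxE; congr (_%:R).
  congr nat_of_bool; apply: eq_forallb => e; by rewrite !ffunE.
rewrite (eq_matter_rot (g := mul_s g) (h := mulf s g)); last by move=> w; rewrite ffunE.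
rewrite (eq_matter_rot (g := invf (mul_s g)) (h := mulf (invf g) (invf s))); last first.
  by move=> w; rewrite /invf /mulf ffunE invMg.
rewrite -!matter_rotM -!mulmxA; do 3 congr (_ *m _).
rewrite -[RHS]mulmx1; congr (_ *m _); rewrite matter_rotM -matter_rot1.
by apply: eq_matter_rot => w; apply: mulVg.
Qed.

(** The commutation holds term by term: [O] and the averaging fields live on [S], where [g] is
    trivial, and [agree_proj] tests only edges with both ends in [S]. *)
Lemma op_gauging_gauge_op_out (S : {set V}) O g :
  supported_on S O -> (forall w, w \in S -> g w = 1%g) ->
  op_gauging L U S O *m gauge_op g = gauge_op g *m op_gauging L U S O.
Proof.
move=> [o eO] g1.
have cO : matter_rot U g *m O = O *m matter_rot U g.
  by rewrite eO; apply: extend_op_comm => w wS; rewrite g1 // repr_mx1.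
rewrite op_gaugingE -scalemxAl -scalemxAr mulmx_suml mulmx_sumr.
congr (_ *: _); apply: eq_bigr => h /forall_inP h1.
have h1' w : w \notin S -> h w = 1%g by move=> wS; apply/eqP/h1; rewrite inE.
have cg (k : V -> gT) : (forall w, w \notin S -> k w = 1%g) ->
    matter_rot U g *m matter_rot U k = matter_rot U k *m matter_rot U g.
  move=> k1; rewrite !matter_rotM; apply: eq_matter_rot => w; rewrite /mulf.
  by have [/g1|/k1] := boolP (w \in S) => ->; rewrite mulg1 mul1g.
rewrite !tensmx_mul gauge_perm_agree_proj; congr (_ *t _); last first.
  congr (_ *m _); congr diag_mx; apply/rowP => a; rewrite !mxE; congr (_%:R).
  congr nat_of_bool; apply: eq_forallb => e; rewrite /mulf.
  by case: andP => // -[eS1 eS2]; rewrite !g1 // !mul1g.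
rewrite !mulmxA cg // -[_ *m matter_rot U g *m O]mulmxA cO !mulmxA.
rewrite -[RHS]mulmxA cg ?mulmxA // => w /h1'; rewrite /invf => ->; exact: invg1.
Qed.

Lemma op_gauging_Pv (S : {set V}) O v : supported_on S O ->
  op_gauging L U S O *m Pv L U v = Pv L U v *m op_gauging L U S O.
Proof.
move=> sO; have cw k : op_gauging L U S O *m gauge_op (single v k) =
    gauge_op (single v k) *m op_gauging L U S O.
  have [vS|vS] := boolP (v \in S); last first.
    apply: op_gauging_gauge_op_out => // w wS; rewrite /single.
    by case: eqP => // e; rewrite -e wS in vS.
  rewrite (eq_gauge_op (h := finfun (single v k))); last by move=> w; rewrite ffunE.
  apply: op_gauging_gauge_op_in => w; rewrite ffunE /single.
  by case: eqP => // ->; rewrite vS.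
rewrite PvE; move: (op_gauging L U S O) cw => K cw.
rewrite -scalemxAl -scalemxAr mulmx_suml mulmx_sumr.
by congr (_ *: _); apply: eq_bigr => k _; rewrite cw.
Qed.

Lemma op_gauging_Bp S O p :
  op_gauging L U S O *m Bp R gT L d p = Bp R gT L d p *m op_gauging L U S O.
Proof.
rewrite op_gaugingE -scalemxAl -scalemxAr mulmx_suml mulmx_sumr.
by congr (_ *: _); apply: eq_bigr => g _; rewrite !tensmx_mul mulmx1 mul1mx diag_mxC.
Qed.

(** * Hermiticity of the terms of the Hamiltonian *)

Lemma op_gauging_herm S O : O \is hermsymmx -> (op_gauging L U S O)^t* = op_gauging L U S O.
Proof.
move=> /hermsymmxP hO; rewrite op_gaugingE adjmxZ adjmx_sum; congr (_ *: _).
  by rewrite fmorphV rmorph_nat.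
apply: eq_bigr => g _; rewrite adjmx_tens adjmx_diag_nat !adjmxM hO !matter_rot_adj.
rewrite (eq_matter_rot (g := invf (invf g)) (h := g)) ?mulmxA // => w.
exact: invgK.
Qed.

Lemma gauge_op_adj g : (gauge_op g)^t* = gauge_op (invf g).
Proof. by rewrite adjmx_tens matter_rot_adj gauge_perm_adj. Qed.

Lemma Pv_herm v : (Pv L U v)^t* = Pv L U v.
Proof.
rewrite PvE adjmxZ adjmx_sum [in RHS](reindex_inj invg_inj) /=; congr (_ *: _).
  by rewrite fmorphV rmorph_nat.
apply: eq_bigr => k _; rewrite gauge_op_adj; apply: eq_gauge_op => w.
by rewrite /invf /single; case: ifP => //; rewrite invg1.
Qed.

Lemma Bp_herm p : (Bp R gT L d p)^t* = Bp R gT L d p.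
Proof. by rewrite adjmx_tens adjmx1 adjmx_diag_nat. Qed.

Lemma H_P_herm : (H_P L U)^t* = H_P L U.
Proof. by rewrite adjmx_sum; apply: eq_bigr => v _; rewrite adjmxB adjmx1 Pv_herm. Qed.

Lemma H_B_herm : (H_B R gT L d)^t* = H_B R gT L d.
Proof. by rewrite adjmx_sum; apply: eq_bigr => p _; rewrite adjmxB adjmx1 Bp_herm. Qed.

(** * Matter components over a fixed edge configuration *)

Definition component (psi : 'cV[C]_(fdim gT E d)) a : 'cV[C]_(mdim d) :=
  \col_i psi (mxtens_index (i, a)) 0.

Lemma component_inj psi psi' :
  (forall a, component psi a = component psi' a) -> psi = psi'.
Proof.
move=> e; apply/colP => k; case: (mxtens_indexP k) => i a.
by have /colP /(_ i) := e a; rewrite !mxE.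
Qed.

Lemma componentZ c psi a : component (c *: psi) a = c *: component psi a.
Proof. by apply/colP => i; rewrite !mxE. Qed.

Lemma componentB psi psi' a :
  component (psi - psi') a = component psi a - component psi' a.
Proof. by apply/colP => i; rewrite !mxE. Qed.

Lemma component_sum (I : finType) (P : pred I) (F : I -> 'cV[C]_(fdim gT E d)) a :
  component (\sum_(i | P i) F i) a = \sum_(i | P i) component (F i) a.
Proof.
by apply/colP => i; rewrite !mxE !summxE; apply: eq_bigr => j _; rewrite mxE.
Qed.

Lemma component_tens (A : 'M[C]_(mdim d)) (B : 'M[C]_(gdim gT E)) psi a :
  component ((A *t B) *m psi) a = \sum_b B a b *: (A *m component psi b).
Proof.
apply/colP => i; rewrite !mxE summxE.
rewrite (reindex (fun p : 'I_(mdim d) * 'I_(gdim gT E) => mxtens_index (p.1, p.2))) /=;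
  last first.
  exists (@mxtens_unindex _ _) => [[j b]|k] _; first exact: mxtens_indexK.
  by rewrite -surjective_pairing mxtens_unindexK.
rewrite -(pair_bigA _ (fun j b => (A *t B) (mxtens_index (i, a)) (mxtens_index (j, b)) *
   psi (mxtens_index (j, b)) 0)) /= exchange_big /=.
apply: eq_bigr => b _; rewrite !mxE mulr_sumr; apply: eq_bigr => j _.
by rewrite tensmxE !mxE mulrA [B a b * _]mulrC.
Qed.

Lemma component_gauge_op g psi a :
  component (gauge_op g *m psi) a = matter_rot U g *m component psi (gact (invf g) a).
Proof.
rewrite component_tens (bigD1 (gact (invf g) a)) //= big1 => [|b ne].
  by rewrite mxE gactVK eqxx scale1r addr0.
rewrite mxE; case: eqP => [e|]; last by rewrite scale0r.
by case/eqP: ne; rewrite e gactK.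
Qed.

Lemma component_diag A (D : 'rV[C]_(gdim gT E)) psi a :
  component ((A *t diag_mx D) *m psi) a = D 0 a *: (A *m component psi a).
Proof.
rewrite component_tens (bigD1 a) //= big1 => [|b ne].
  by rewrite mxE eqxx mulr1n addr0.
by rewrite mxE eq_sym (negbTE ne) mulr0n scale0r.
Qed.

Definition trivial_config : 'I_(gdim gT E) := config_index (fun=> 1%g).

Lemma component_vacuum (psi : 'cV[C]_(mdim d)) a :
  component (psi *t gauge_vacuum R gT E : 'cV[C]_(fdim gT E d)) a =
  (a == trivial_config)%:R *: psi.
Proof.
apply/colP => i; rewrite !mxE mxtens_indexK /= !ord1 mulrC; congr (_ * _).
rewrite -[RHS]/((_ == _)%:R : C).
transitivity (\prod_(e : E) (edge_val a e == 1%g)%:R : C).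
  apply: eq_bigr => e _; rewrite mxE andbT; congr (_%:R); congr nat_of_bool.
  by rewrite /edge_val -(inj_eq enum_val_inj) enum_rankK.
rewrite prod_nat_eq; congr (_%:R); congr nat_of_bool.
apply/forallP/eqP => [e|-> e]; last by rewrite edge_val_index.
by apply: edge_val_inj => e'; rewrite edge_val_index; apply/eqP.
Qed.

(* A state fixed by all constraints vanishes off the flat configurations, which
   are gauge translates of the trivial one since the surface is simply
   connected. *)
Lemma constrained_eq0 psi :
  connected_on L [set: V] -> simply_connected L ->
  (forall v, Pv L U v *m psi = psi) ->
  (forall p, p \in faces L -> Bp R gT L d p *m psi = psi) ->
  component psi trivial_config = 0 -> psi = 0.
Proof.
move=> conn sc fP fB psi0; apply: component_inj => a.
have -> : component 0 a = 0 by apply/colP => i; rewrite !mxE.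
have [/forall_inP flat|] := boolP [forall p in faces L, flat_at L p (edge_val a)].
  have [g eg] := flat_is_pure_gauge conn sc flat.
  have -> : a = gact g trivial_config.
    apply: edge_val_inj => e; rewrite eg edge_val_gact /gauge_config.
    by rewrite edge_val_index.
  by rewrite -(gauge_op_fixed g fP) component_gauge_op gactK psi0 mulmx0.
rewrite negb_forall_in => /existsP [p /andP [pf /negbTE nflat]].
by rewrite -(fB p pf) component_diag mxE nflat scale0r.
Qed.

(** Equality propagates along edges inside [S]. Hence only fields constant on [S] have trivial pure
    gauge configuration there. *)
Lemma connected_const (S : {set V}) g : connected_on L S ->
  (forall e, vplus L e \in S -> vminus L e \in S -> g (vminus L e) = g (vplus L e)) ->
  {in S &, forall x y, g x = g y}.
Proof.
move=> [_ conn] eg x y xS yS; have /connectP [p] := conn x y xS yS.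
elim: p x {xS} => [|z p IH] x /=; first by move=> _ ->.
case/andP => /and3P [xS zS /existsP [e adj]] pz ey; rewrite -(IH z pz ey).
by case/orP: adj xS zS => /andP [/eqP <- /eqP <-] eS eS'; rewrite eg.
Qed.

(** Over the trivial configuration, only the fields constant on [S] survive in the average. There is
    one for each group element, and each conjugates [O] to itself by symmetry, so the average
    returns [O]. *)
Lemma component_op_gauging (S : {set V}) O psi :
  connected_on L S -> supported_on S O ->
  (forall k, O *m global_sym U k = global_sym U k *m O) ->
  component (op_gauging L U S O *m psi) trivial_config =
  O *m component psi trivial_config.
Proof.
move=> conn [o eO] symO; have [/set0Pn [s0 s0S] _] := conn.
pose h k : {ffun V -> gT} := [ffun w => if w \in S then k else 1%g].
(* Factor [g] as the constant field [k] times [g']. The field [g'] is 1 on [S] and commutes with [O]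
   by locality; the constant field commutes with [O] by symmetry. *)
have constO g : {in S &, forall x y, g x = g y} ->
    matter_rot U g *m O *m matter_rot U (invf g) = O.
  move=> cg; set k := g s0; pose g' : V -> gT := fun w => (k^-1 * g w)%g.
  have eg : matter_rot U g = global_sym U k *m matter_rot U g'.
    by rewrite matter_rotM; apply: eq_matter_rot => w; rewrite /mulf /g' mulKVg.
  have cO : matter_rot U g' *m O = O *m matter_rot U g'.
    rewrite eO; apply: extend_op_comm => w wS.
    by rewrite /g' (cg w s0) // mulVg repr_mx1.
  by rewrite {1}eg -[_ *m _ *m O]mulmxA cO mulmxA -symO -mulmxA -mulmxA
    [_ *m (_ *m matter_rot U (invf g))]mulmxA -eg matter_rotV mulmx1.
rewrite op_gaugingE -scalemxAl componentZ mulmx_suml component_sum.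
under eq_bigr do rewrite component_diag mxE.
rewrite (bigID (fun g : {ffun V -> gT} => [forall x in S, forall y in S, g x == g y])) /=.
rewrite [X in _ + X]big1 ?addr0; last first.
  move=> g /andP [_ nc]; case: forallP => [fe|]; last by rewrite scale0r.
  case/negP: nc; apply/forall_inP => x xS; apply/forall_inP => y yS; apply/eqP.
  apply: (connected_const conn) => // e e1 e2; apply/eqP.
  have := fe e; rewrite e1 e2 edge_val_index /=.
  by rewrite eq_sym -eq_mulgV1.
(* The surviving fields correspond to their value at the base vertex [s0], since they are 1 off
   [S]. *)
rewrite (reindex_onto h (fun g : {ffun V -> gT} => g s0)) /=; last first.
  move=> g /andP [/forall_inP g1 /forall_inP cg]; apply/ffunP => w; rewrite ffunE.
  case: ifPn => wS; last by apply/esym/eqP/g1; rewrite inE.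
  by apply/eqP; have /forall_inP := cg s0 s0S; apply.
rewrite -[RHS]average_const; congr (_ *: _).
have hS k : {in S &, forall x y, h k x = h k y} by move=> x y xS yS; rewrite !ffunE xS yS.
apply: eq_big => [k|k _].
  rewrite ffunE s0S eqxx andbT; apply/andP; split.
    by apply/forall_inP => w; rewrite inE ffunE => /negbTE ->.
  by apply/forall_inP => x xS; apply/forall_inP => y yS; rewrite (hS k x y).
rewrite constO //; case: forallP => [_|[] e]; first by rewrite scale1r.
by apply/implyP => /andP [e1 e2]; rewrite edge_val_index !ffunE e1 e2 mulgV.
Qed.

(** * Gauged states *)

Definition symmetric_state (psi : 'cV[C]_(mdim d)) : Prop :=
  forall k, global_sym U k *m psi = psi.

Lemma Pgauge_fixed v (psi : 'cV[C]_(fdim gT E d)) :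
  Pv L U v *m (Pgauge L U *m psi) = Pgauge L U *m psi.
Proof.
have e : Pv L U v *m Pgauge L U = Pgauge L U.
  exact: (mulmx_big_absorb (Q := Pv L U) Pv_idem Pv_comm (mem_index_enum v)).
by rewrite mulmxA e.
Qed.

(** The plaquette projector commutes with the gauge projector and fixes the vacuum, whose holonomies
    are all 1. *)
Lemma state_gauging_flat p psi : Bp R gT L d p *m state_gauging L U psi = state_gauging L U psi.
Proof.
have e : Bp R gT L d p *m Pgauge L U = Pgauge L U *m Bp R gT L d p.
  exact: (mulmx_big_comm (Q := Pv L U) (index_enum V) (Bp_Pv p)).
rewrite /state_gauging mulmxA e.
rewrite -mulmxA; congr (_ *m _); apply: component_inj => a.
rewrite component_diag mul1mx component_vacuum mxE.
case: eqP => [->|_]; last by rewrite scale0r scaler0.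
rewrite (flat_at_eq _ _ (edge_val_index _)) (_ : flat_at _ _ _) ?scale1r //.
apply/forall_inP => x _; apply/eqP; elim: (boundary L x) => // y s IH.
by rewrite holonomy_cons IH /dart_val; case: ifP; rewrite ?invg1 mulg1.
Qed.

(** This gives both that the gauged state is nonzero and how it restricts to matter. The constant is
    the proportion of gauge fields that fix the trivial configuration. *)
Lemma component_state_gauging psi : connected_on L [set: V] -> symmetric_state psi ->
  exists2 c : C, c != 0 & component (state_gauging L U psi) trivial_config = c *: psi.
Proof.
move=> conn sym; set Phi := state_gauging L U psi.
set x0 : 'cV[C]_(fdim gT E d) := psi *t gauge_vacuum R gT E.
have fPhi v : Pv L U v *m Phi = Phi by exact: Pgauge_fixed.
(* The sum over all gauge fields has explicit components. Applying [Pgauge], which fixes the sum and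
   turns each term into [Phi], identifies it with a multiple of [Phi]. *)
pose Phi1 := \sum_(g : {ffun V -> gT}) gauge_op g *m x0.
have fPhi1 v : Pv L U v *m Phi1 = Phi1.
  apply: Pv_avg => k; rewrite mulmx_sumr.
  pose mul_s (g : {ffun V -> gT}) : {ffun V -> gT} := [ffun w => single v k w * g w]%g.
  have mul_s_inj : injective mul_s.
    by move=> g h /ffunP e; apply/ffunP => w; have := e w; rewrite !ffunE => /mulgI.
  rewrite [RHS](reindex_inj mul_s_inj); apply: eq_bigr => g _.
  by rewrite mulmxA gauge_opM; congr (_ *m _); apply: eq_gauge_op => w; rewrite ffunE.
have ePhi1 : Phi1 = #|{ffun V -> gT}|%:R *: Phi.
  have <- : Pgauge L U *m Phi1 = Phi1 by exact: mulmx_big_fixed fPhi1.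
  rewrite mulmx_sumr.
  rewrite (eq_bigr (fun=> Phi)); last first.
    move=> g _; have e : gauge_op g *m Pgauge L U = Pgauge L U *m gauge_op g.
      exact: (mulmx_big_comm (Q := Pv L U) (index_enum V) (gauge_op_Pv g)).
    by rewrite mulmxA -e -mulmxA; apply: gauge_op_fixed.
  by rewrite sumr_const -[Phi *+ _]scaler_nat.
(* By connectivity the counted fields are constant, so each fixes [psi] and contributes one copy of
   it. The identity field makes [N] positive. *)
pose N := #|[set g : {ffun V -> gT} | gact (invf g) trivial_config == trivial_config]|.
have comp1 : component Phi1 trivial_config = N%:R *: psi.
  rewrite component_sum /N -sum1_card natr_sum scaler_suml [RHS]big_mkcond /=.
  apply: eq_bigr => g _; rewrite component_gauge_op component_vacuum inE.
  case: eqP => [e|_]; last by rewrite scale0r mulmx0.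
  rewrite !scale1r; have [/set0Pn [v0 _] _] := conn.
  rewrite -[RHS](sym (g v0)); congr (_ *m _); apply: eq_matter_rot => w.
  apply: (connected_const conn); rewrite ?inE // => x _ _.
  have := congr1 (fun a => edge_val a x) e.
  rewrite edge_val_gact !edge_val_index mulg1 /invf invgK => /eqP.
  by rewrite -eq_mulVg1 => /eqP.
have cardn0 : #|{ffun V -> gT}|%:R != 0 :> C.
  by rewrite pnatr_eq0 -lt0n; apply/card_gt0P; exists [ffun=> 1%g].
exists (#|{ffun V -> gT}|%:R^-1 * N%:R).
  rewrite mulf_neq0 ?invr_eq0 // pnatr_eq0 -lt0n; apply/card_gt0P.
  exists [ffun=> 1%g]; rewrite inE -{2}[trivial_config]gact1; apply/eqP/eq_gact => w.
  by rewrite /invf ffunE invg1.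
by rewrite -scalerA -comp1 -componentZ ePhi1 scalerA mulVf // scale1r.
Qed.

End GaugeTheory.

(** * Ground state and gap of the full Hamiltonian *)

Theorem mainTheorem2 (R : realType) (gT : finGroupType) (V E : finType)
    (L : embedded_digraph V E)
    (L_connected : connected_on L [set: V])
    (L_simply_connected : simply_connected L)
    (d : V -> nat)
    (U : forall v, mx_representation R[i] [set: gT]%G (d v))
    (U_unitary : forall v g, U v g \is unitarymx)
    (Gam : V -> {set V})
    (Gam_connected : forall v, connected_on L (Gam v))
    (h : V -> 'M[R[i]]_(mdim d))
    (h_herm : forall v, h v \is hermsymmx)
    (h_local : forall v, supported_on (Gam v) (h v))
    (h_sym : forall v g, h v *m global_sym U g = global_sym U g *m h v)
    (lambda0 : 'cV[R[i]]_(mdim d))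
    (lambda0_ground : unique_ground_state (H_matter h) 0 lambda0)
    (lambda0_sym : forall g, global_sym U g *m lambda0 = lambda0)
    (DeltaM : R)
    (DeltaM_gap : gap_above (H_matter h) 0 DeltaM) :
  exists M : R, forall DeltaB DeltaP : R, M <= DeltaB -> M <= DeltaP ->
    exists (E0 : R[i]) (DeltaFull : R),
      [/\ unique_ground_state (H_full L U Gam h DeltaB DeltaP) E0
            (state_gauging L U lambda0),
          gap_above (H_full L U Gam h DeltaB DeltaP) E0 DeltaFull &
          Num.min DeltaM (Num.min DeltaB DeltaP) <= DeltaFull].
Proof.
pose K := \sum_v op_gauging L U (Gam v) (h v).
have hK : K^t* = K.
  by rewrite adjmx_sum; apply: eq_bigr => v _; apply: op_gauging_herm.
have [c c0 lbK] := energy_lower_bound (introT (hermsymmxP _) hK).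
have KPv v : K *m Pv L U v = Pv L U v *m K.
  rewrite mulmx_suml mulmx_sumr; apply: eq_bigr => w _; exact: op_gauging_Pv.
have KBp p : K *m Bp R gT L d p = Bp R gT L d p *m K.
  rewrite mulmx_suml mulmx_sumr; apply: eq_bigr => w _; exact: op_gauging_Bp.
have Ktriv psi : component (K *m psi) (trivial_config gT E) =
    H_matter h *m component psi (trivial_config gT E).
  rewrite /K /H_matter !mulmx_suml component_sum; apply: eq_bigr => v _.
  exact: component_op_gauging.
have [lowM DM0 [psi1 psi10 ev1] gapM] := DeltaM_gap.
have [_ lambda00 lambda0_uniq] := lambda0_ground.
set Phi := state_gauging L U lambda0.
have [c1 c10 compPhi] := component_state_gauging L_connected lambda0_sym.
have fPhi v : Pv L U v *m Phi = Phi by exact: Pgauge_fixed.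
have bPhi p : Bp R gT L d p *m Phi = Phi by exact: state_gauging_flat.
rewrite -/Phi in compPhi; clearbody Phi.
have Phi0 : Phi != 0.
  apply/eqP => e; have /eqP := compPhi; rewrite e.
  rewrite (_ : component 0 _ = 0); last by apply/colP => i; rewrite !mxE.
  by rewrite eq_sym scaler_eq0 (negbTE c10) (negbTE lambda00).
have HMlambda0 : H_matter h *m lambda0 = 0.
  have /lambda0_uniq -> : exists k, lambda0 = k *: lambda0 by exists 1; rewrite scale1r.
  exact: scale0r.
(* The vector [K *m Phi] again satisfies all constraints, and its component over the trivial
   configuration is a multiple of [H_matter h *m lambda0], which is 0. *)
have KPhi : K *m Phi = 0.
  apply: (constrained_eq0 (U := U) L_connected L_simply_connected) => [v|p _|].
  - by rewrite mulmxA -KPv -mulmxA fPhi.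
  - by rewrite mulmxA -KBp -mulmxA bPhi.
  - by rewrite Ktriv compPhi -scalemxAr HMlambda0 scaler0.
(* As [K] is bounded below by [- c], this threshold makes a single penalty raise the energy to at
   least [DeltaM]. *)
exists (DeltaM + c) => DB DP leB leP; exists 0.
set H := H_full L U Gam h DB DP.
have eHfixed psi : (forall v, Pv L U v *m psi = psi) ->
    (forall p, p \in faces L -> Bp R gT L d p *m psi = psi) -> H *m psi = K *m psi.
  move=> fP fB; rewrite /H /H_full !mulmxDl -!scalemxAl !mulmx_suml.
  rewrite [X in _ + _ *: X + _]big1 => [|p pf]; last by rewrite mulmxBl mul1mx fB // subrr.
  rewrite [X in _ + _ + _ *: X]big1 => [|v _]; last by rewrite mulmxBl mul1mx fP subrr.
  by rewrite !scaler0 !addr0.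
have HPhi : H *m Phi = 0 by rewrite eHfixed.
(* Both kinds of constraints form one family. Dart sets that are not faces receive the identity,
   hence a zero penalty term. *)
pose Q (i : V + {set dart E}) : 'M[R[i]]_(fdim gT E d) := match i with
  | inl v => Pv L U v
  | inr p => if p \in faces L then Bp R gT L d p else 1%:M
  end.
pose D (i : V + {set dart E}) : R := if i is inl _ then DP else DB.
have eH : H = K + \sum_i (D i)%:C *: (1%:M - Q i).
  rewrite big_sumType /= /H /H_full -addrA [X in _ + X]addrC /H_P /H_B !scaler_sumr.
  congr (_ + (_ + _)); rewrite big_mkcond; apply: eq_bigr => p _.
  by case: ifP => // _; rewrite subrr scaler0.
have idQ i : Q i *m Q i = Q i.
  case: i => [v|p] /=; first exact: Pv_idem.
  by case: ifP => _; [exact: Bp_idem | rewrite mulmx1].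
have cQ i j : Q i *m Q j = Q j *m Q i.
  case: i j => [v|p] [w|q] /=.
  - exact: Pv_comm.
  - by case: ifP => _; [exact/esym/Bp_Pv | rewrite mulmx1 mul1mx].
  - by case: ifP => _; [exact: Bp_Pv | rewrite mulmx1 mul1mx].
  case: ifP => _; last by rewrite mulmx1 mul1mx.
  by case: ifP => _; [exact: Bp_comm | rewrite mulmx1 mul1mx].
have cK i : K *m Q i = Q i *m K.
  case: i => [v|p] /=; first exact: KPv.
  by case: ifP => _; [exact: KBp | rewrite mulmx1 mul1mx].
have lbD i : DeltaM + c <= D i by case: i.
have dich Ex psi : H *m psi = Ex *: psi ->
    DeltaM%:C <= Ex \/ [/\ forall v, Pv L U v *m psi = psi,
      forall p, p \in faces L -> Bp R gT L d p *m psi = psi &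
      H_matter h *m component psi (trivial_config gT E) =
        Ex *: component psi (trivial_config gT E)].
  move=> ev; case: (altP (@forallP _ (fun i => Q i *m psi == psi))) => [fQ|]; last first.
    rewrite negb_forall => /existsP nf; left.
    exact: (penalty_bound eH idQ cQ cK lbK c0 (ltW DM0) lbD ev nf).
  have fP v : Pv L U v *m psi = psi by exact/eqP/(fQ (inl v)).
  have fB p : p \in faces L -> Bp R gT L d p *m psi = psi.
    by move=> pf; have /eqP := fQ (inr p); rewrite /= pf.
  by right; split=> //; rewrite -Ktriv -eHfixed // ev componentZ.
have DM0C : 0 < DeltaM%:C :> R[i] by rewrite ltcR.
(* In the constrained case the component over the trivial configuration is nonzero, so [Ex] is an
   energy of the matter Hamiltonian. *)
have bound Ex : energy H Ex -> 0 <= Ex /\ (Ex != 0 -> DeltaM%:C <= Ex).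
  move=> [psi psi0 ev]; have [le|[fP fB evM]] := dich _ _ ev.
    by split=> //; apply: le_trans le; apply: ltW.
  have eM : energy (H_matter h) Ex.
    exists (component psi (trivial_config gT E)) => //.
    apply: contra_neq psi0.
    exact: (constrained_eq0 (U := U)) L_connected L_simply_connected fP fB.
  split; first by case: lowM => _; apply.
  by move=> Ex0; have := gapM _ eM Ex0; rewrite add0r.
have lowH : lowest_energy H 0.
  by split=> [|Ex /bound []] //; exists Phi; rewrite // HPhi scale0r.
have uniqH psi : H *m psi = 0 *: psi <-> exists k, psi = k *: Phi.
  split=> [ev|[k ->]]; last by rewrite -scalemxAr HPhi scaler0 scale0r.
  have [le|[fP fB]] := dich _ _ ev.
    by have := lt_le_trans DM0C le; rewrite ltxx.
  (* Dividing by [c1] matches the components over the trivial configuration; the difference is then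
     a constrained state whose component there is zero. *)
  move/lambda0_uniq => [k ek]; exists (k / c1); apply/eqP; rewrite -subr_eq0; apply/eqP.
  apply: (constrained_eq0 (U := U) L_connected L_simply_connected) => [v|p pf|].
  - by rewrite mulmxBr -scalemxAr fP fPhi.
  - by rewrite mulmxBr -scalemxAr fB // bPhi.
  - by rewrite componentB componentZ compPhi ek scalerA divfK // subrr.
(* If [H] vanished, every vector would be a multiple of [Phi]. Applied to the excited matter state
   [psi1] over the gauge vacuum, this makes [psi1] a multiple of [lambda0], contradicting its energy
   [DeltaM > 0]. *)
have H0 : H != 0.
  apply/eqP => H0.
  have [k] : exists k, (psi1 *t gauge_vacuum R gT E : 'cV_(fdim gT E d)) = k *: Phi.
    by apply/uniqH; rewrite H0 mul0mx scale0r.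
  move/(congr1 (fun x => component x (trivial_config gT E))).
  rewrite component_vacuum eqxx scale1r componentZ compPhi scalerA => e.
  have /eqP := ev1; rewrite {1}e -scalemxAr HMlambda0 scaler0 add0r eq_sym.
  by rewrite scaler_eq0 (negbTE psi10) (gt_eqF DM0C).
have hH : H \is hermsymmx.
  apply/hermsymmxP; rewrite /H /H_full -/K; move: (K) hK => K' hK'.
  have conjR (x : R) : Num.conj (x%:C : R[i]) = x%:C by exact: conjc_real.
  have hB := H_B_herm R gT L d; have hP := H_P_herm L U_unitary.
  move: (H_B _ _ _ _) (H_P _ _) hB hP => HB HP hB hP.
  by rewrite !adjmxD !adjmxZ hK' hB hP !conjR.
(* The gap is in fact at least [DeltaM], which dominates the required minimum. *)
have [Dfull gapH leD] := gap_aboveI hH H0 DM0 lowH (fun Ex e => (bound Ex e).2).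
exists Dfull; split=> //.
by rewrite ge_min leD.
Qed.
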